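(* Let $d$ be an arbitrary positive integer and let $\Gamma\subset\mathcal I_d$ be a nonempty set satisfying one of the following assumptions: 1. $|\Gamma|\leq 2$; 2. one of the components of $(i,j,k)$ is fixed for all elements of $\Gamma$ (that is, all elements of $\Gamma$ have the same first component, or all have the same second component, or all have the same third component); 3. $\Gamma=\mathcal I_d$; 4. $\Gamma=\{(i,j,k)\in \mathcal I_d: \; i\geq i_0,\, j \geq j_0,\, k \geq k_0\}$ for fixed non-negative integers $i_0, j_0, k_0$; 5. $\Gamma \subset \mathcal I_d^{(2)} \cup \mathcal I_d^{(1)}$; 6. $\Gamma=\Gamma_1\cup\Gamma_2$, where $\Gamma_1$ is a set of one of the types described in 1, 2 or 4, and $\Gamma_2$ is a set of the type described in 5. Then $\det M_{\Gamma}>0$.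
   Context: For a positive integer $d$, let $\mathcal I_d$ be the set of all triples $\boldsymbol i=(i,j,k)$ of non-negative integers with $i+j+k=d$. For $z\in\{0,1,2\}$, $\mathcal I_d^{(z)}\subset\mathcal I_d$ denotes the subset of all triples having exactly $z$ components equal to zero. For a triangle $T$ in the plane, points are written in barycentric coordinates $\boldsymbol v=(u,v,w)$, $u+v+w=1$, with respect to $T$. The Bernstein basis polynomials of total degree $d$ are $B^d_{\boldsymbol i}(\boldsymbol v):=\frac{d!}{i!\,j!\,k!}u^iv^jw^k$ for $\boldsymbol i=(i,j,k)\in\mathcal I_d$, with the convention $0^0=1$. The domain points are $\xi_{\boldsymbol i}:=\boldsymbol i/d=(i/d,j/d,k/d)$ (barycentric coordinates), $\boldsymbol i\in\mathcal I_d$. For a nonempty $\Gamma\subset\mathcal I_d$, $M_\Gamma:=[B^d_{\boldsymbol j}(\xi_{\boldsymbol i})]_{\boldsymbol i,\boldsymbol j\in\Gamma}$ is the $|\Gamma|\times|\Gamma|$ matrix with rows indexed by $\boldsymbol i\in\Gamma$ and columns by $\boldsymbol j\in\Gamma$, using the same ordering of $\Gamma$ for rows and columns (the determinant does not depend on this ordering). The inclusion sign $\subset$ does not mean strict inclusion. *)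

(* Defs.v *)
From mathcomp Require Import all_boot all_order all_algebra.
Set Implicit Arguments.
Unset Strict Implicit.
Unset Printing Implicit Defensive.
Import Order.TTheory GRing.Theory Num.Theory.
Local Open Scope ring_scope.

(* Components of a triple (i, j, k) with i + j + k = d are at most d, so such
   triples live in this finite type; [Idx d] selects those summing to d. *)
Notation triple d := ('I_d.+1 * 'I_d.+1 * 'I_d.+1)%type.

Definition ci d (t : triple d) : nat := t.1.1.
Definition cj d (t : triple d) : nat := t.1.2.
Definition ck d (t : triple d) : nat := t.2.

Definition Idx (d : nat) : {set triple d} :=
  [set t | (ci t + cj t + ck t == d)%N].

Definition Idx_zeros (d z : nat) : {set triple d} :=
  [set t in Idx d |
    ((ci t == 0) + (cj t == 0) + (ck t == 0) == z)%N].

(* A point is given by its barycentric coordinates (u, v, w).  The convention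
   0 ^ 0 = 1 is built into [^+]. *)
Definition bernstein (R : realFieldType) d (t : triple d) (p : R * R * R) : R :=
  (d`!)%:R / ((ci t)`!%:R * (cj t)`!%:R * (ck t)`!%:R)
  * p.1.1 ^+ ci t * p.1.2 ^+ cj t * p.2 ^+ ck t.

Definition domain_point (R : realFieldType) d (t : triple d) : R * R * R :=
  ((ci t)%:R / d%:R, (cj t)%:R / d%:R, (ck t)%:R / d%:R).

(* Rows and columns both follow the enumeration of Gamma given by [enum_val]. *)
Definition colloc_mx (R : realFieldType) d (Gamma : {set triple d})
    : 'M[R]_#|Gamma| :=
  \matrix_(a < #|Gamma|, b < #|Gamma|)
    bernstein (enum_val b) (domain_point R (enum_val a)).

Definition at_most_two d (Gamma : {set triple d}) : Prop := (#|Gamma| <= 2)%N.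

Definition fixed_component d (Gamma : {set triple d}) : Prop :=
  [\/ exists i0 : nat, forall t, t \in Gamma -> ci t = i0,
      exists j0 : nat, forall t, t \in Gamma -> cj t = j0
    | exists k0 : nat, forall t, t \in Gamma -> ck t = k0].

Definition lower_bounded d (Gamma : {set triple d}) : Prop :=
  exists i0 j0 k0 : nat,
    Gamma = [set t in Idx d |
      [&& (i0 <= ci t)%N, (j0 <= cj t)%N & (k0 <= ck t)%N]].

Definition on_boundary d (Gamma : {set triple d}) : Prop :=
  Gamma \subset Idx_zeros d 2 :|: Idx_zeros d 1.

Definition union_with_boundary d (Gamma : {set triple d}) : Prop :=
  exists Gamma1 Gamma2 : {set triple d},
    [/\ Gamma = Gamma1 :|: Gamma2,
        [\/ at_most_two Gamma1, fixed_component Gamma1 | lower_bounded Gamma1]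
      & on_boundary Gamma2].

(* Main.v *)
Require Import Defs.
From mathcomp Require Import all_boot all_order all_algebra.
From mathcomp Require Import perm zify ring.
Set Implicit Arguments.
Unset Strict Implicit.
Unset Printing Implicit Defensive.
Import Order.TTheory GRing.Theory Num.Theory.
Local Open Scope ring_scope.

(** Every admissible [Gamma] is the union of a set of type 1, 2 or 4 and a subset
    of the boundary.  By homogeneity, [bernstein t] at [domain_point s] is a
    positive factor depending only on [t] times the integer [power_entry s t].
    This entry vanishes as soon as the support of [t] is not contained in that of
    [s].  Grouping [Gamma] by supports, that is by the vertices, open edges and
    interior of the triangle, therefore makes the matrix block triangular
    ([sdet_block_gt0]), and the determinant is the product of those of the
    diagonal blocks.  A vertex block has size at most one.  In an edge block one
    component is fixed and the other two are positive.  The interior block keeps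
    only interior points of the set of type 1, 2 or 4, and it is again of that
    type.  Three situations remain.

    - One component is fixed, the other two, [p] and [q], are positive.  Dividing
      each row by a power of [q] gives the generalized Vandermonde matrix of the
      nodes [p / q], which increase with [p]; its determinant is positive
      ([gen_vandermonde_gt0]).

    - There are at most two points.  Here the inequality is
      [a ^ b * b ^ a < a ^ a * b ^ b] for [a != b] ([ltn_mul_expn_swap]), applied
      to each component.

    - The set is cut out by lower bounds on the components
      ([sdet_lower_set_gt0]).  Its matrix [M] represents an operator of Bernstein
      type, which is triangular for the degree filtration and has positive
      eigenvalues.  In matrix form, [M * D * F = F * U * C], where [D] and [C] are
      diagonal with positive entries, [F] evaluates products of binomial
      coefficients on the array, and [U] expands monomials in these products.
      Both [F] and [U] are triangular with positive diagonals, so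
      [\det M > 0]. *)

(** * Determinants indexed by finite sets *)

(** The diagonal blocks below are indexed by subsets of [A], which have no canonical
    place among the ordinals; this form lets one split and factor determinants
    without handling the enumerations. *)
Definition sdet (R : comPzRingType) (T : finType) (A : {set T}) (f : T -> T -> R) : R :=
  \det (\matrix_(a < #|A|, b < #|A|) f (enum_val a) (enum_val b)).

(** Rows and columns are permuted simultaneously, so the two signs cancel. *)
Lemma sdet_enum (R : comPzRingType) (T : finType) (A : {set T}) (n : nat)
    (e : 'I_n -> T) (f : T -> T -> R) :
  #|A| = n -> injective e -> (forall i, e i \in A) ->
  \det (\matrix_(i, j) f (e i) (e j)) = sdet A f.
Proof.
move=> cardA; move: e; rewrite -{}cardA => e e_inj eA.
pose s0 i := enum_rank_in (eA i) (e i).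
have s0K i : enum_val (s0 i) = e i by rewrite enum_rankK_in.
have s0_inj : injective s0.
  by move=> i j eq_ij; apply: e_inj; rewrite -!s0K eq_ij.
pose s := perm s0_inj; pose M := \matrix_(a < #|A|, b < #|A|) f (enum_val a) (enum_val b).
have ->: \matrix_(i, j) f (e i) (e j) = row_perm s (col_perm s M).
  by apply/matrixP=> i j; rewrite !mxE !permE !s0K.
by rewrite row_permE col_permE !det_mulmx !det_perm odd_permV mulrCA -signr_addb
  addbb mulr1.
Qed.

Lemma eq_sdet (R : comPzRingType) (T : finType) (A : {set T}) (f g : T -> T -> R) :
  {in A &, f =2 g} -> sdet A f = sdet A g.
Proof.
by move=> eq_fg; congr (\det _); apply/matrixP=> a b; rewrite !mxE eq_fg ?enum_valP.
Qed.

Lemma sdet_mul (R : comPzRingType) (T : finType) (A : {set T}) (f g : T -> T -> R) :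
  sdet A (fun i j => \sum_(k in A) f i k * g k j) = sdet A f * sdet A g.
Proof.
rewrite -det_mulmx; congr (\det _); apply/matrixP=> a b; rewrite !mxE big_enum_val.
by apply: eq_bigr => c _; rewrite !mxE.
Qed.

Lemma sdet_diag (R : comPzRingType) (T : finType) (A : {set T}) (f : T -> T -> R) :
  {in A &, forall i j, i != j -> f i j = 0} -> sdet A f = \prod_(i in A) f i i.
Proof.
move=> f0; rewrite big_enum_val /sdet.
set M := (X in \det X).
have ->: M = diag_mx (\row_a f (enum_val a) (enum_val a)).
  apply/matrixP=> a b; rewrite !mxE; have [->|neq_ab] := eqVneq a b; first by [].
  by rewrite mulr0n f0 ?enum_valP // (inj_eq enum_val_inj).
by rewrite det_diag; apply: eq_bigr => a _; rewrite mxE.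
Qed.

(** Listing [B] before its complement makes the matrix lower block triangular. *)
Lemma sdet_split (R : comPzRingType) (T : finType) (A B : {set T}) (f : T -> T -> R) :
  {in A :&: B & A :\: B, forall i j, f i j = 0} ->
  sdet A f = sdet (A :&: B) f * sdet (A :\: B) f.
Proof.
move=> f0; set C := A :&: B; set D := A :\: B.
pose e (i : 'I_(#|C| + #|D|)) : T :=
  match split i with inl a => enum_val a | inr b => enum_val b end.
have el a : e (lshift _ a) = enum_val a by rewrite /e (unsplitK (inl a)).
have er b : e (rshift _ b) = enum_val b by rewrite /e (unsplitK (inr b)).
have CP (a : 'I_#|C|) : enum_val a \in C := enum_valP a.
have DP (b : 'I_#|D|) : enum_val b \in D := enum_valP b.
have e_inj : injective e.
  move=> i j; rewrite -(splitK i) -(splitK j).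
  case: (split i) (split j) => [a|a] [b|b] /=; rewrite ?el ?er.
  - by move=> /enum_val_inj ->.
  - move=> eq_ab; have := DP b; rewrite -eq_ab inE; have := CP a; rewrite inE.
    by case/andP=> _ ->.
  - move=> eq_ab; have := DP a; rewrite eq_ab inE; have := CP b; rewrite inE.
    by case/andP=> _ ->.
  - by move=> /enum_val_inj ->.
have eA i : e i \in A.
  rewrite -(splitK i); case: (split i) => a /=; rewrite ?el ?er.
    by have := CP a; rewrite inE => /andP[].
  by have := DP a; rewrite inE => /andP[].
rewrite -(sdet_enum f _ e_inj eA); last by rewrite cardsID.
set M := \matrix_(i, j) _.
rewrite -(submxK M) (_ : ursubmx M = 0) ?det_lblock; last first.
  by apply/matrixP=> a b; rewrite !mxE el er f0 ?CP ?DP.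
by congr (_ * _); congr (\det _); apply/matrixP=> a b; rewrite !mxE ?el ?er.
Qed.

Lemma sdet_scale_gt0 (R : realDomainType) (T : finType) (A : {set T})
    (r c : T -> R) (f g : T -> T -> R) :
  {in A, forall i, 0 < r i} -> {in A, forall i, 0 < c i} ->
  {in A &, forall i j, g i j = r i * f i j * c j} ->
  0 < sdet A f -> 0 < sdet A g.
Proof.
move=> r0 c0 gE f0.
have prodE (u : T -> R) :
    \prod_(i in A) u i = \det (diag_mx (\row_(a < #|A|) u (enum_val a))).
  by rewrite det_diag big_enum_val; apply: eq_bigr => a _; rewrite mxE.
have ->: sdet A g = (\prod_(i in A) r i) * sdet A f * \prod_(i in A) c i.
  rewrite !prodE -!det_mulmx mul_diag_mx mul_mx_diag; congr (\det _).
  by apply/matrixP=> a b; rewrite !mxE gE ?enum_valP.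
by rewrite !mulr_gt0 // prodr_gt0.
Qed.

(** The level sets of [h] are split off one at a time, from the highest down. *)
Lemma sdet_block_gt0 (R : realDomainType) (T : finType) (A : {set T}) (h : T -> nat)
    (f : T -> T -> R) :
  {in A &, forall i j, (h i < h j)%N -> f i j = 0} ->
  (forall k, 0 < sdet [set x in A | h x == k] f) ->
  0 < sdet A f.
Proof.
have empty (B : {set T}) : (forall x, x \notin B) -> 0 < sdet B f.
  by move=> B0; rewrite sdet_diag ?big_pred0 // => [x|x]; have /negPf-> := B0 x.
move=> f0 lev0.
have [N ltN] : exists N, {in A, forall x, (h x < N)%N}.
  by exists (\max_(x in A) h x).+1 => x xA; rewrite ltnS; apply: leq_bigmax_cond.
elim: N => [|N IH] in A f0 lev0 ltN *; first by apply: empty => x; apply/negP=> /ltN.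
rewrite (@sdet_split _ _ _ [set x | (h x < N)%N]) => [|i j]; last first.
  rewrite !inE => /andP[iA ltiN] /andP[lejN jA].
  by apply: f0 => //; apply: leq_trans ltiN _; rewrite leqNgt.
rewrite mulr_gt0 //.
  apply: IH => [i j|k|i].
  - by rewrite !inE => /andP[iA _] /andP[jA _]; apply: f0.
  - have [ltkN | leNk] := ltnP k N.
      rewrite (_ : finset _ = [set x in A | h x == k]); first exact: lev0.
      by apply/setP=> x; rewrite !inE; case: eqP => [->|]; rewrite ?ltkN ?andbT ?andbF.
    apply: empty => x; rewrite !inE; apply/negP=> /andP[/andP[_ ltx] /eqP hx].
    by move: ltx; rewrite hx ltnNge leNk.
  - by rewrite !inE => /andP[].
rewrite (_ : A :\: _ = [set x in A | h x == N]); first exact: lev0.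
apply/setP=> x; rewrite !inE -leqNgt andbC eqn_leq.
by case xA: (x \in A); rewrite //= -[(h x <= N)%N]ltnS ltN.
Qed.

(** On a level set of [h] the matrix is diagonal, which lets the degree of a
    multi-index serve as [h]. *)
Lemma sdet_triangular_gt0 (R : realDomainType) (T : finType) (A : {set T})
    (h : T -> nat) (f : T -> T -> R) :
  {in A, forall i, 0 < f i i} ->
  {in A &, forall i j, i != j -> (h i <= h j)%N -> f i j = 0} ->
  0 < sdet A f.
Proof.
move=> f_gt0 f0; apply: (@sdet_block_gt0 _ _ _ h) => [i j iA jA lt_ij|k].
  by apply: f0 => //; [apply: contraTneq lt_ij => ->; rewrite ltnn | apply: ltnW].
rewrite sdet_diag => [|i j]; last first.
  by rewrite !inE => /andP[iA /eqP hi] /andP[jA /eqP hj] neq; apply: f0; rewrite // hi hj.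
by apply: prodr_gt0 => i; rewrite inE => /andP[iA _]; apply: f_gt0.
Qed.

(** * Generalized Vandermonde determinants *)

(** Multilinearity in all rows at once: one term of each row's sum is chosen. *)
Lemma det_row_sum (R : comPzRingType) (n N : nat) (c : 'I_n -> 'I_N -> R)
    (g : 'I_N -> 'I_n -> R) :
  \det (\matrix_(i, j) \sum_l c i l * g l j) =
  \sum_(f : {ffun 'I_n -> 'I_N}) (\prod_i c i (f i)) * \det (\matrix_(i, j) g (f i) j).
Proof.
rewrite /determinant.
under [RHS]eq_bigr => f _ do rewrite big_distrr /=.
rewrite exchange_big /=; apply: eq_bigr => s _.
under eq_bigr => i _ do rewrite mxE.
rewrite bigA_distr_bigA big_distrr /=; apply: eq_bigr => f _.
rewrite mulrCA big_split /=; congr (_ * (_ * _)).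
by apply: eq_bigr => i _; rewrite mxE.
Qed.

Lemma telescope_powers (R : comPzRingType) (x y : R) (a b : nat) : (a <= b)%N ->
  (x - y) * \sum_(a <= l < b) y ^+ (b - l.+1) * x ^+ l = x ^+ b - y ^+ (b - a) * x ^+ a.
Proof.
move=> le_ab; rewrite big_distrr /=.
transitivity (\sum_(a <= l < b) (y ^+ (b - l.+1) * x ^+ l.+1 - y ^+ (b - l) * x ^+ l)).
  apply: eq_big_nat => l /andP[_ lt_lb].
  by rewrite -[(b - l)%N](subnSK lt_lb) !exprS; ring.
by rewrite telescope_sumr // subnn mul1r.
Qed.

(** Induction on the size.  Subtracting from each column the multiple of the previous
    one that cancels its entry in the first row leaves
    [x i ^+ m (j + 1) - x0 ^+ (m (j + 1) - m j) * x i ^+ m j], which is [x i - x0] times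
    a positive combination of the powers of [x i] with exponents in the interval
    from [m j] to [m (j + 1) - 1] ([telescope_powers]).  These intervals are disjoint
    and increasing, so expanding by multilinearity yields only generalized
    Vandermonde determinants with strictly increasing exponents, one size smaller.
    This is the branching rule of Schur polynomials. *)
Lemma gen_vandermonde_gt0 (R : realFieldType) (n : nat) (x : 'I_n -> R) (m : 'I_n -> nat) :
  (forall i, 0 < x i) -> (forall i j : 'I_n, (i < j)%N -> x i < x j) ->
  (forall i j : 'I_n, (i < j)%N -> (m i < m j)%N) ->
  0 < \det (\matrix_(i, j) x i ^+ m j).
Proof.
elim: n => [|n IH] in x m *; first by rewrite det_mx00.
move=> x_gt0 x_incr m_incr.
pose x0 := x ord0; pose w (k : 'I_n) := widen_ord (leqnSn n) k.
pose A := \matrix_(i, j) x i ^+ m j.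
(* [A *m U] is [A] after the column operations. *)
pose U := \matrix_(k < n.+1, j < n.+1)
  ((k == j)%:R - (k.+1 == j :> nat)%:R * x0 ^+ (m j - m k)).
have detU : \det U = 1.
  rewrite -det_tr det_trig.
    apply: big1 => i _; rewrite !mxE eqxx (_ : (i.+1 == i :> nat) = false) ?mul0r ?subr0 //.
    by apply/negbTE; rewrite neq_ltn ltnSn orbT.
  apply/is_trig_mxP=> i j lt_ij; rewrite !mxE.
  rewrite -val_eqE /= gtn_eqF // gtn_eqF ?mul0r ?subr0 //.
  exact: leqW.
have B0 i : (A *m U) i ord0 = x i ^+ m ord0.
  rewrite mxE (bigD1 ord0) //= big1 => [|k neq_k0]; rewrite !mxE.
    by rewrite eqxx mul0r subr0 mulr1 addr0.
  by rewrite (negbTE neq_k0) mul0r subr0 mulr0.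
have BS i j : (A *m U) i (lift ord0 j) =
    x i ^+ m (lift ord0 j) - x0 ^+ (m (lift ord0 j) - m (w j)) * x i ^+ m (w j).
  have neq : lift ord0 j != w j by rewrite -val_eqE /= /bump leq0n add1n neq_ltn ltnSn orbT.
  rewrite mxE (bigD1 (lift ord0 j)) //= (bigD1 (w j)) /=; last by rewrite eq_sym.
  rewrite big1 => [|k /andP[neq1 neq2]]; rewrite !mxE.
    rewrite eqxx [w j == _]eq_sym (negbTE neq) /= /bump leq0n add1n eqxx gtn_eqF //.
    by rewrite addr0 mul0r mul1r; ring.
  rewrite (negbTE neq1) (_ : (k.+1 == _) = false) ?mul0r ?subr0 ?mulr0 //.
  apply/negbTE; apply: contra neq2; rewrite /= /bump leq0n add1n eqSS -val_eqE /=.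
  by [].
have lt_wS j : (m (w j) < m (lift ord0 j))%N by apply: m_incr; rewrite /= /bump leq0n.
pose N := m ord_max.
have le_N j : (m (lift ord0 j) <= N)%N.
  have := leq_ord (lift ord0 j); rewrite leq_eqVlt => /orP[/eqP eq_n|lt_n].
    by rewrite (_ : lift ord0 j = ord_max) //; apply: val_inj.
  exact/ltnW/m_incr.
pose c (j : 'I_n) (l : 'I_N) : R :=
  if (m (w j) <= l < m (lift ord0 j))%N then x0 ^+ (m (lift ord0 j) - l.+1) else 0.
pose y (i : 'I_n) := x (lift ord0 i).
have detA : \det A = x0 ^+ m ord0 * (\prod_i (y i - x0) *
    \det (\matrix_(j, i) \sum_l c j l * y i ^+ l)).
  rewrite -[LHS]mulr1 -{1}detU -det_mulmx (expand_det_row _ ord0) big_ord_recl B0.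
  rewrite big1 ?addr0 => [|j _]; last first.
    by rewrite BS -exprD subnK ?subrr ?mul0r // ltnW.
  congr (_ * _); rewrite /cofactor expr0 mul1r.
  rewrite (_ : \prod_i (y i - x0) = \det (diag_mx (\row_i (y i - x0)))); last first.
    by rewrite det_diag; apply: eq_bigr => i _; rewrite mxE.
  rewrite -[X in _ * X]det_tr -det_mulmx mul_diag_mx; congr (\det _).
  apply/matrixP=> i j; rewrite 2![LHS]mxE BS !mxE -(telescope_powers _ _ (ltnW (lt_wS j))).
  congr (_ * _); rewrite (big_nat_widen _ _ N) // (big_nat_widenl _ 0) //.
  rewrite big_mkord big_mkcond; apply: eq_bigr => l _; rewrite /c andTb andbC.
  by case: ifP => // _; rewrite mul0r.
have x0_gt0 : 0 < x0 := x_gt0 ord0.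
rewrite -/A detA mulr_gt0 ?exprn_gt0 // mulr_gt0 //.
  by apply: prodr_gt0 => i _; rewrite subr_gt0 x_incr.
rewrite (det_row_sum c (fun l i => y i ^+ l)).
have term_gt0 (f : {ffun 'I_n -> 'I_N}) :
    (forall j, (m (w j) <= f j < m (lift ord0 j))%N) ->
    0 < (\prod_i c i (f i)) * \det (\matrix_(i, j) y j ^+ f i).
  move=> fP; rewrite mulr_gt0 //.
    by apply: prodr_gt0 => j _; rewrite /c fP exprn_gt0.
  rewrite -det_tr (_ : _^T = \matrix_(i, j) y i ^+ f j); last first.
    by apply/matrixP=> i j; rewrite !mxE.
  apply: (IH y (fun j => val (f j))) => [i|i j lt_ij|i j lt_ij]; first exact: x_gt0.
    by apply: x_incr; rewrite /= /bump !leq0n ltnS.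
  have /andP[_ lt1] := fP i; have /andP[le2 _] := fP j.
  apply: leq_trans lt1 (leq_trans _ le2).
  have := lt_ij; rewrite leq_eqVlt => /orP[/eqP eq_ij|lt_Sij].
    by rewrite (_ : lift ord0 i = w j) //; apply: val_inj; rewrite /= /bump leq0n -eq_ij.
  by apply: ltnW; apply: m_incr; rewrite /= /bump leq0n.
(* One term of the expansion is positive; the others are nonnegative. *)
pose f0 : {ffun 'I_n -> 'I_N} := [ffun j => Ordinal (leq_trans (lt_wS j) (le_N j))].
rewrite (bigD1 f0) //= ltr_wpDr //; last first.
  by apply: term_gt0 => j; rewrite ffunE /= leqnn lt_wS.
apply: sumr_ge0 => f _.
have [/forallP fP|] := boolP [forall j, (m (w j) <= f j < m (lift ord0 j))%N].
  exact/ltW/term_gt0.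
rewrite negb_forall => /existsP[j /negbTE fj].
by rewrite (bigD1 j) //= /c fj !mul0r.
Qed.
(** * Two varying coordinates *)

(** After division of row [s] by [q s ^ N], the entries are powers of the nodes
    [p s / q s].  These increase with [p s] because [p s + q s] is constant; the
    points are sorted by [p] so that nodes and exponents increase together. *)
Lemma sdet_two_powers_gt0 (R : realFieldType) (T : finType) (A : {set T})
    (p q : T -> nat) (N : nat) :
  {in A, forall t, [/\ (0 < p t)%N, (0 < q t)%N & (p t + q t)%N = N]} ->
  {in A &, injective p} ->
  0 < sdet A (fun s t => (p s ^ p t * q s ^ q t)%:R : R).
Proof.
move=> pqA p_inj.
pose x t : R := (p t)%:R / (q t)%:R.
have q_gt0 t : t \in A -> 0 < (q t)%:R :> R by case/pqA=> _ qt _; rewrite ltr0n.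
apply: (@sdet_scale_gt0 _ _ _ (fun s => (q s)%:R ^+ N) (fun=> 1) (fun s t => x s ^+ p t)).
- by move=> s sA; rewrite exprn_gt0 ?q_gt0.
- by [].
- move=> s t sA tA; rewrite /x natrM !natrX mulr1 expr_div_n.
  have [_ _ <-] := pqA t tA; rewrite exprD.
  by field; rewrite expf_neq0 // gt_eqF ?q_gt0.
pose S := sort (relpre p leq) (enum A).
have size_S : size S = #|A| by rewrite size_sort cardE.
(* The default value of [nth] is never reached; any element will do. *)
pose e (i : 'I_#|A|) := nth (enum_val i) S i.
have eA i : e i \in A.
  by rewrite -mem_enum -(mem_sort (relpre p leq)) mem_nth // size_S.
have pS_sorted : sorted ltn (map p S).
  rewrite ltn_sorted_uniq_leq map_inj_in_uniq; last first.
    by move=> s t; rewrite !mem_sort !mem_enum; apply: p_inj.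
  rewrite sort_uniq enum_uniq sorted_map sort_sorted // => s t.
  exact: leq_total.
have pe_incr (i j : 'I_#|A|) : (i < j)%N -> (p (e i) < p (e j))%N.
  move=> lt_ij.
  have := sorted_ltn_nth ltn_trans 0%N pS_sorted i j.
  rewrite !inE size_map size_S !ltn_ord => /(_ isT isT lt_ij).
  by rewrite (nth_map (enum_val i)) ?size_S // (nth_map (enum_val j)) ?size_S.
rewrite -(@sdet_enum _ _ _ _ e) //; last first.
  by move=> i j eq_e; case: (ltngtP i j) => [/pe_incr|/pe_incr|/val_inj //];
     rewrite eq_e ltnn.
apply: (gen_vandermonde_gt0 (x := x \o e) (m := p \o e)) => [i|i j|]; last exact: pe_incr.
  by have [? ? _] := pqA _ (eA i); rewrite divr_gt0 ?ltr0n.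
move=> /pe_incr lt_p /=; have [? ? eqi] := pqA _ (eA i); have [? ? eqj] := pqA _ (eA j).
rewrite ltr_pdivrMr ?ltr0n // mulrAC ltr_pdivlMr ?ltr0n // -!natrM ltr_nat.
by rewrite ltn_mul //; lia.
Qed.

(** * At most two domain points *)

(** For [a < b], cancel [a ^ a * b ^ a]: there remains [a ^ c < b ^ c] with
    [c = b - a].  The case [a = 0] is included, with [0 ^ 0 = 1]. *)
Lemma ltn_mul_expn_swap (a b : nat) : a != b -> (a ^ b * b ^ a < a ^ a * b ^ b)%N.
Proof.
wlog lt_ab : a b / (a < b)%N => [W neq_ab|_].
  have [/W->//|/W|eq_ab] := ltngtP a b; last by rewrite eq_ab eqxx in neq_ab.
  by rewrite eq_sym neq_ab mulnC [X in (_ < X)%N]mulnC => ->.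
pose c := (b - a)%N; have c_gt0 : (0 < c)%N by rewrite subn_gt0.
have bE : b = (a + c)%N by rewrite subnKC // ltnW.
rewrite [X in (a ^ X * _ < _ * b ^ X)%N]bE !expnD.
rewrite mulnAC [X in (_ < X)%N]mulnA ltn_pmul2l ?ltn_exp2r //.
by rewrite muln_gt0 !expn_gt0 (leq_ltn_trans _ lt_ab) // andbT lt0n orNb.
Qed.

Lemma leq_mul_expn_swap (a b : nat) : (a ^ b * b ^ a <= a ^ a * b ^ b)%N.
Proof. by have [->|/ltn_mul_expn_swap/ltnW] := eqVneq a b. Qed.

(** The collocation matrix up to positive row and column factors, with integer
    entries: homogeneity removes the denominators [d]. *)
Definition power_entry d (s t : triple d) : nat :=
  (ci s ^ ci t * cj s ^ cj t * ck s ^ ck t)%N.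

Lemma colloc_det_gt0 (R : realFieldType) d (A : {set triple d}) : (0 < d)%N ->
  A \subset Idx d ->
  0 < sdet A (fun s t => (power_entry s t)%:R : R) -> 0 < \det (colloc_mx R A).
Proof.
move=> d_gt0 /subsetP AI det_gt0.
pose c (t : triple d) : R := (d`!)%:R / ((ci t)`!%:R * (cj t)`!%:R * (ck t)`!%:R) / d%:R ^+ d.
rewrite -[\det _]/(sdet A (fun s t => bernstein t (domain_point R s))).
apply: (sdet_scale_gt0 (r := fun=> 1 : R) (c := c) _ _ _ det_gt0) => // [t _|s t _ /AI].
  by rewrite /c !(divr_gt0, mulr_gt0, exprn_gt0, invr_gt0) ?ltr0n ?fact_gt0.
rewrite inE => /eqP sum_t; rewrite /bernstein /domain_point /c /power_entry /=.
have sum_d (x : R) : x ^+ d = x ^+ ci t * x ^+ cj t * x ^+ ck t.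
  by rewrite -!exprD sum_t.
rewrite !natrM !natrX mul1r !expr_div_n sum_d.
have d0 : d%:R != 0 :> R by rewrite pnatr_eq0 -lt0n.
by field; rewrite !expf_neq0 // !pnatr_eq0 -!lt0n !fact_gt0.
Qed.

Lemma triple_eq d (s t : triple d) :
  s \in Idx d -> t \in Idx d -> ci s = ci t -> cj s = cj t -> s = t.
Proof.
case: s t => [[a b] c] [[a' b'] c']; rewrite !inE /ci /cj /ck /=.
move=> /eqP sum_s /eqP sum_t eq_a eq_b.
by congr (_, _, _); apply: val_inj => //=; lia.
Qed.

Lemma det_mx22 (R : comPzRingType) (M : 'M[R]_2) :
  \det M = M ord0 ord0 * M ord_max ord_max - M ord0 ord_max * M ord_max ord0.
Proof.
rewrite (expand_det_row _ ord0) !big_ord_recl big_ord0 addr0 /cofactor !det_mx11 !mxE.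
have -> : lift ord0 (0 : 'I_1) = ord_max by apply: val_inj.
have -> : lift (@ord_max 1) (0 : 'I_1) = ord0 by apply: val_inj.
by rewrite /= expr0 mul1r expr1 mulN1r mulrN.
Qed.

(** The diagonal product exceeds the antidiagonal one component by component, and
    strictly in the first or second component if the two points differ. *)
Lemma sdet_at_most_two_gt0 (R : realFieldType) d (A : {set triple d}) :
  A \subset Idx d -> (#|A| <= 2)%N ->
  0 < sdet A (fun s t => (power_entry s t)%:R : R).
Proof.
move=> /subsetP AI; rewrite leq_eqVlt => /orP[/cards2P[x [y [neq_xy defA]]]|]; last first.
  rewrite ltnS => /card_le1_eqP A1.
  rewrite sdet_diag => [|s t sA tA]; last by rewrite (A1 _ _ sA tA) eqxx.
  apply: prodr_gt0 => s _; rewrite ltr0n !muln_gt0 !expn_gt0.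
  by rewrite !lt0n !orNb.
have xA : x \in A by rewrite defA !inE eqxx.
have yA : y \in A by rewrite defA !inE eqxx orbT.
pose e (i : 'I_2) := if i == ord0 then x else y.
have eA i : e i \in A by rewrite /e; case: ifP.
have e_inj : injective e.
  move=> i j; rewrite /e; case: i j => [[|[|//]] ?] [[|[|//]] ?] //=;
    do ?by move=> _; apply: val_inj.
  - by move=> eq_xy; rewrite eq_xy eqxx in neq_xy.
  - by move=> eq_xy; rewrite eq_xy eqxx in neq_xy.
rewrite -(sdet_enum _ _ e_inj eA) ?{1}defA ?cards2 ?neq_xy //.
rewrite det_mx22 !mxE /e /= subr_gt0 -!natrM ltr_nat /power_entry.
have swap a b c a' b' c' : (a * b * c * (a' * b' * c') = a * a' * (b * b') * (c * c'))%N.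
  by rewrite !mulnA; lia.
rewrite !swap.
have self_gt0 a b : (0 < a ^ a * b ^ b)%N.
  by rewrite muln_gt0 !expn_gt0 !lt0n !orNb.
have ltn_mulr_leq a b r s : (0 < s)%N -> (a < r -> b <= s -> a * b < r * s)%N.
  move=> s_gt0 lt_ar le_bs; apply: leq_ltn_trans (leq_mul (leqnn _) le_bs) _.
  by rewrite ltn_pmul2r.
have le3 := leq_mul_expn_swap (ck x) (ck y).
apply: (ltn_mulr_leq) => //.
have [eq_i|neq_i] := eqVneq (ci x) (ci y); last first.
  by apply: (ltn_mulr_leq); rewrite ?self_gt0 ?ltn_mul_expn_swap ?leq_mul_expn_swap.
have neq_j : cj x != cj y.
  by apply: contra neq_xy => /eqP eq_j; apply/eqP/triple_eq => //; apply: AI.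
rewrite mulnC [X in (_ < X)%N]mulnC.
by apply: (ltn_mulr_leq); rewrite ?self_gt0 ?ltn_mul_expn_swap ?leq_mul_expn_swap.
Qed.

(** * Triangular arrays of domain points *)

(** Coefficients of [(p + i0) ^ g] in the basis of binomial coefficients
    ['C(p, k)] ([k`!] times the r-Stirling numbers of the second kind). *)
Fixpoint newton_coef (i0 g k : nat) : nat :=
  if g is g'.+1 then (i0 + k) * newton_coef i0 g' k + k * newton_coef i0 g' k.-1
  else k == 0%N.

Lemma newton_coef_small i0 g k : (g < k)%N -> newton_coef i0 g k = 0%N.
Proof.
elim: g k => [|g IH] [|k] //= lt_gk.
by rewrite !IH ?muln0 // ltnW.
Qed.

Lemma newton_coef_diag_gt0 i0 g : (0 < newton_coef i0 g g)%N.
Proof. by elim: g => //= g IH; rewrite addn_gt0 [X in _ || X]muln_gt0 IH orbT. Qed.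

(** Multiply the expansion for [g] by [p + i0 = (i0 + k) + (p - k)] and absorb [p - k]
    by [(p - k) * 'C(p, k) = k.+1 * 'C(p, k.+1)]. *)
Lemma expn_newton i0 p g N : (g < N)%N ->
  ((p + i0) ^ g = \sum_(k < N) 'C(p, k) * newton_coef i0 g k)%N.
Proof.
elim: g N => [|g IH] [|N] // lt_gN.
  by rewrite big_ord_recl big1 ?bin0 // => i _; rewrite muln0.
have step k : ((p + i0) * ('C(p, k) * newton_coef i0 g k) =
    'C(p, k) * ((i0 + k) * newton_coef i0 g k) + k.+1 * 'C(p, k.+1) * newton_coef i0 g k)%N.
  rewrite mul_bin_left; have [le_kp|lt_pk] := leqP k p; last by rewrite bin_small // !muln0.
  by rewrite -{1}(subnK le_kp); ring.
rewrite expnS (IH N.+1) ?(ltnW lt_gN) // big_distrr /=.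
under eq_bigr => k _ do rewrite step.
under [RHS]eq_bigr => k _ do rewrite mulnDr.
rewrite !big_split /=; congr addn.
rewrite big_ord_recr [RHS]big_ord_recl /= newton_coef_small // mul0n !muln0 add0n addn0.
by apply: eq_bigr => k _; rewrite /bump leq0n add1n /=; ring.
Qed.

(** Factorial moments of the binomial distribution, in homogeneous form: they show
    that the Bernstein operator maps binomial coefficients to single monomials. *)
Lemma sum_bin_moment (m c N y z : nat) : (m < N)%N ->
  (\sum_(b < N) 'C(m, b) * 'C(b, c) * (y ^ b * z ^ (m - b)) =
   'C(m, c) * y ^ c * (y + z) ^ (m - c))%N.
Proof.
elim: c m N => [|c IH] m N lt_mN.
  rewrite bin0 !mul1n subn0 addnC expnDn.
  rewrite (big_ord_widen N (fun i => 'C(m, i) * (z ^ (m - i) * y ^ i))%N) //.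
  rewrite [RHS]big_mkcond; apply: eq_bigr => b _.
  rewrite bin0 muln1 ltnS; case: leqP => [_|lt_mb]; first by rewrite [(y ^ _ * _)%N]mulnC.
  by rewrite bin_small.
case: N lt_mN => // N; rewrite ltnS; case: m => [_|m lt_mN].
  rewrite mul0n big1 // => [[[|b] ltb] _] /=; first by rewrite muln0.
  by rewrite bin0n.
apply/eqP; rewrite -(eqn_pmul2l (ltn0Sn c)); apply/eqP.
rewrite big_ord_recl bin0n muln0 mul0n add0n.
have e0 := mul_bin_diag m.+1 c; rewrite /= in e0.
transitivity (m.+1 * y * ('C(m, c) * y ^ c * (y + z) ^ (m - c)))%N; last first.
  by rewrite !mulnA -e0 subSS expnS; ring.
rewrite -(IH m N) // !big_distrr /=; apply: eq_bigr => b _.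
rewrite /bump leq0n add1n subSS expnS.
have e1 := mul_bin_diag m.+1 b; have e2 := mul_bin_diag b.+1 c; rewrite /= in e1 e2.
transitivity (('C(m.+1, b.+1) * (c.+1 * 'C(b.+1, c.+1))) * (y * y ^ b * z ^ (m - b)))%N.
  by ring.
rewrite -e2.
transitivity ((b.+1 * 'C(m.+1, b.+1)) * 'C(b, c) * (y * y ^ b * z ^ (m - b)))%N.
  by ring.
by rewrite -e1; ring.
Qed.

(** Both sides are the trinomial coefficient of [a], [b] and [n - a - b]. *)
Lemma bin_swap (n a b : nat) : ('C(n, a) * 'C(n - a, b) = 'C(n, b) * 'C(n - b, a))%N.
Proof.
have [le_ab_n|lt_n_ab] := leqP (a + b) n; last first.
  have z a' b' : (n < a' + b')%N -> ('C(n, a') * 'C(n - a', b') = 0)%N.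
    have [le_n lt_n|lt_n _] := leqP a' n; last by rewrite bin_small.
    by rewrite (bin_small (m := b')) ?muln0 //; lia.
  by rewrite !z // addnC.
apply/eqP; rewrite -(@eqn_pmul2r (a`! * b`! * (n - a - b)`!)) ?muln_gt0 ?fact_gt0 //.
have e a' b' : (a' + b' <= n)%N ->
    ('C(n, a') * 'C(n - a', b') * (a'`! * b'`! * (n - a' - b')`!) = n`!)%N.
  move=> le_n.
  rewrite -(@bin_fact n a') -1?(@bin_fact (n - a') b'); [by ring|lia|lia].
rewrite e //; have := e b a; rewrite addnC subnAC [(b`! * _)%N]mulnC => -> //.
Qed.

Definition lower_set d (i0 j0 k0 : nat) : {set triple d} :=
  [set t in Idx d | [&& (i0 <= ci t)%N, (j0 <= cj t)%N & (k0 <= ck t)%N]].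

(** An array cut out by lower bounds is a translate of the full array of degree [n];
    letting [G] vanish outside the array turns the sum into one over a square, which
    separates the variables. *)
Lemma sum_lower_set d i0 j0 k0 n (G : nat -> nat -> nat) :
  (i0 + j0 + k0 + n)%N = d -> (forall a b, (n < a + b)%N -> G a b = 0%N) ->
  (\sum_(t in lower_set d i0 j0 k0) G (ci t - i0) (cj t - j0) =
   \sum_(a < n.+1) \sum_(b < n.+1) G a b)%N.
Proof.
move=> sum_d G0; rewrite pair_big /=.
rewrite [RHS](bigID (fun p : 'I_n.+1 * 'I_n.+1 => p.1 + p.2 <= n)%N) /=.
rewrite [X in (_ = _ + X)%N]big1 ?addn0 => [|p]; last by rewrite -ltnNge => /G0.
pose h (p : 'I_n.+1 * 'I_n.+1) : triple d :=
  (inord (p.1 + i0), inord (p.2 + j0), inord (n - p.1 - p.2 + k0)).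
pose h' (t : triple d) : 'I_n.+1 * 'I_n.+1 := (inord (ci t - i0), inord (cj t - j0)).
have hP (p : 'I_n.+1 * 'I_n.+1) : (p.1 + p.2 <= n)%N ->
    [/\ ci (h p) = p.1 + i0, cj (h p) = p.2 + j0 & ck (h p) = n - p.1 - p.2 + k0]%N.
  by move=> le_n; rewrite /ci /cj /ck /h /=; rewrite !inordK; try lia.
rewrite [RHS](reindex_onto h' h) /=; last first.
  move=> p /hP[eq_i eq_j _]; rewrite /h' eq_i eq_j !addnK; case: p {eq_i eq_j} => a b /=.
  by rewrite !inord_val.
have h'P t : t \in lower_set d i0 j0 k0 ->
    [/\ ((h' t).1 = ci t - i0 :> nat)%N, ((h' t).2 = cj t - j0 :> nat)%N &
       (h' t).1 + (h' t).2 <= n]%N.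
  rewrite !inE /h' => /andP[/eqP sum_t /and3P[la lb lc]] /=.
  by rewrite !inordK; [split; lia | lia | lia].
apply: eq_big => [t|t /h'P[-> -> _] //].
apply/idP/andP => [tA|[le_n /eqP <-]].
  have [eq_i eq_j le_n] := h'P t tA; have [ei ej ek] := hP _ le_n.
  move: tA; rewrite !inE => /andP[/eqP sum_t /and3P[la lb lc]].
  split=> //; apply/eqP; apply: triple_eq; rewrite ?inE; try apply/eqP; lia.
have {}le_n : ((h' t).1 + (h' t).2 <= n)%N := le_n.
have [ei ej ek] := hP (h' t) le_n.
by rewrite !inE ei ej ek !leq_addl !andbT; apply/eqP; lia.
Qed.

Lemma sum_natrM (R : pzSemiRingType) (T : finType) (A : {set T}) (u v : T -> nat) :
  \sum_(t in A) (u t)%:R * (v t)%:R = (\sum_(t in A) u t * v t)%N%:R :> R.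
Proof. by rewrite natr_sum; apply: eq_bigr => t _; rewrite natrM. Qed.

(** With translated indices [a t], [b t] and [n - a t - b t], the entries are the
    monomials [M s t].  Summing [M s t] against the trinomial weights [D t] and the
    products of binomials [F t u] gives, by [sum_bin_moment] applied twice, a
    multiple of the monomial [V s u], the remaining power being that of
    [ci s + cj s + ck s = d].  Expanding [V] in Newton form gives [V = F * U], so
    the factor [\det F] occurs on both sides of [M * D * F = F * U * C]. *)
Lemma sdet_lower_set_gt0 (R : realFieldType) d (i0 j0 k0 : nat) : (0 < d)%N ->
  0 < sdet (lower_set d i0 j0 k0) (fun s t => (power_entry s t)%:R : R).
Proof.
move=> d_gt0; set A := lower_set d i0 j0 k0.
have [lt_d|le_d] := ltnP d (i0 + j0 + k0).
  have A0 t : t \in A -> False by rewrite !inE => /andP[/eqP sum_t /and3P[]]; lia.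
  by rewrite sdet_diag ?big1 // => [t /A0|t ? /A0].
pose n := (d - (i0 + j0 + k0))%N.
have sum_d : (i0 + j0 + k0 + n)%N = d by rewrite subnKC.
pose a (t : triple d) := (ci t - i0)%N; pose b (t : triple d) := (cj t - j0)%N.
have AP t : t \in A -> [/\ ci t = a t + i0, cj t = b t + j0,
    ck t = n - a t - b t + k0, a t + b t <= n & ci t + cj t + ck t = d]%N.
  by rewrite !inE /a /b => /andP[/eqP sum_t /and3P[? ? ?]]; split; lia.
have A_inj s t : s \in A -> t \in A -> s != t -> (a s != a t) || (b s != b t).
  move=> sA tA; rewrite -negb_and; apply: contra => /andP[/eqP eq_a /eqP eq_b].
  have [is_ js _ _ sum_s] := AP s sA; have [it jt _ _ sum_t] := AP t tA.
  by apply/eqP/triple_eq; rewrite ?inE ?sum_s ?sum_t ?is_ ?js ?it ?jt ?eq_a ?eq_b.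
pose M (s t : triple d) := (ci s ^ a t * cj s ^ b t * ck s ^ (n - a t - b t))%N.
pose D t := ('C(n, a t) * 'C(n - a t, b t))%N.
pose F s t := ('C(a s, a t) * 'C(b s, b t))%N.
pose U s t := (newton_coef i0 (a t) (a s) * newton_coef j0 (b t) (b s))%N.
pose V (s t : triple d) := (ci s ^ a t * cj s ^ b t)%N.
pose C t := ('C(n, b t) * 'C(n - b t, a t) * d ^ (n - b t - a t))%N.
apply: (@sdet_scale_gt0 _ _ _ (fun s => (ci s ^ i0 * cj s ^ j0 * ck s ^ k0)%:R)
  (fun=> 1) (fun s t => (M s t)%:R)) => // [s sA|s t sA tA|].
- move: sA; rewrite !inE => /andP[_ /and3P[le_i le_j le_k]].
  have gt0 x y : (y <= x)%N -> (0 < x ^ y)%N.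
    by rewrite expn_gt0; case: x => //; case: y.
  by rewrite ltr0n !muln_gt0 !gt0.
- have [it jt kt _ _] := AP t tA.
  by rewrite mulr1 -natrM /power_entry /M it jt kt !expnD; congr _%:R; ring.
(* The operator is triangular: [M * D * F = V * C]. *)
have MDF s u : s \in A -> u \in A -> (\sum_(t in A) M s t * (D t * F t u) = V s u * C u)%N.
  move=> sA uA; have [_ _ _ le_u _] := AP u uA; have [_ _ _ _ sum_s] := AP s sA.
  pose x := ci s; pose y := cj s; pose z := ck s.
  pose G p q := ('C(n, p) * 'C(p, a u) * x ^ p *
    ('C(n - p, q) * 'C(q, b u) * (y ^ q * z ^ (n - p - q))))%N.
  rewrite (eq_bigr (fun t => G (a t) (b t))) => [|t _]; last first.
    by rewrite /M /D /F /G /x /y /z; ring.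
  rewrite (sum_lower_set sum_d) => [|p q lt_n]; last first.
    rewrite /G; have [le_pn|lt_np] := leqP p n; last by rewrite bin_small.
    by rewrite (@bin_small (n - p)) ?muln0 //; lia.
  under eq_bigr => p _ do rewrite -big_distrr /= sum_bin_moment ?ltnS ?leq_subr //.
  transitivity ('C(n, b u) * y ^ b u * \sum_(p < n.+1)
    'C(n - b u, p) * 'C(p, a u) * (x ^ p * (y + z) ^ (n - b u - p)))%N.
    rewrite big_distrr; apply: eq_bigr => p _ /=.
    transitivity ('C(n, p) * 'C(n - p, b u) * ('C(p, a u) * x ^ p *
      (y ^ b u * (y + z) ^ (n - p - b u))))%N; first by ring.
    by rewrite bin_swap subnAC; ring.
  rewrite sum_bin_moment ?ltnS ?leq_subr // addnA (_ : x + y + z = d)%N //.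
  by rewrite /V /C -/x -/y; ring.
have VFU s u : s \in A -> u \in A -> (\sum_(t in A) F s t * U t u = V s u)%N.
  move=> sA uA; have [_ _ _ le_u _] := AP u uA; have [is_ js _ _ _] := AP s sA.
  pose G p q := ('C(a s, p) * newton_coef i0 (a u) p *
    ('C(b s, q) * newton_coef j0 (b u) q))%N.
  rewrite (eq_bigr (fun t => G (a t) (b t))) => [|t _]; last by rewrite /F /U /G; ring.
  rewrite (sum_lower_set sum_d) => [|p q lt_n]; last first.
    rewrite /G; have [le_p|lt_p] := leqP p (a u).
      by rewrite (@newton_coef_small j0) ?muln0 //; lia.
    by rewrite (@newton_coef_small i0) // muln0.
  rewrite /V is_ js (@expn_newton i0 _ _ n.+1) ?(@expn_newton j0 _ _ n.+1); try lia.
  by rewrite big_distrlr.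
have FP s t : F s t != 0%N -> (a t <= a s)%N /\ (b t <= b s)%N.
  by rewrite -lt0n /F muln_gt0 !bin_gt0 => /andP.
have UP s t : U s t != 0%N -> (a s <= a t)%N /\ (b s <= b t)%N.
  rewrite /U => nz; split; rewrite leqNgt; apply: contra nz => lt_st.
    by rewrite newton_coef_small.
  by rewrite [X in (_ * X)%N]newton_coef_small ?muln0.
have detF : 0 < sdet A (fun s t => (F s t)%:R : R).
  apply: (@sdet_triangular_gt0 _ _ _ (fun t => a t + b t)%N) => [t _|s t sA tA neq le_st].
    by rewrite /F !binn ltr01.
  apply/eqP; rewrite pnatr_eq0; apply: contraT => /FP[le_a le_b].
  by have := A_inj s t sA tA neq; lia.
have detU : 0 < sdet A (fun s t => (U s t)%:R : R).
  apply: (@sdet_triangular_gt0 _ _ _ (fun t => n - (a t + b t))%N) => [t _|s t sA tA neq].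
    by rewrite ltr0n muln_gt0 !newton_coef_diag_gt0.
  have [_ _ _ le_s _] := AP s sA; have [_ _ _ le_t _] := AP t tA => le_st.
  apply/eqP; rewrite pnatr_eq0; apply: contraT => /UP[le_a le_b].
  by have := A_inj s t sA tA neq; lia.
have detV : 0 < sdet A (fun s t => (V s t)%:R : R).
  rewrite -(@eq_sdet _ _ _ (fun s u => \sum_(t in A) (F s t)%:R * (U t u)%:R)).
    by rewrite sdet_mul mulr_gt0.
  by move=> s u sA uA; rewrite sum_natrM VFU.
have detDF : 0 < sdet A (fun s t => (D s * F s t)%:R : R).
  apply: (@sdet_scale_gt0 _ _ _ (fun s => (D s)%:R) (fun=> 1) _ _ _ _ _ detF) => //.
    by move=> s sA; have [_ _ _ le_s _] := AP s sA; rewrite ltr0n muln_gt0 !bin_gt0; lia.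
  by move=> s t _ _; rewrite mulr1 natrM.
have detVC : 0 < sdet A (fun s t => (V s t * C t)%:R : R).
  apply: (@sdet_scale_gt0 _ _ _ (fun=> 1) (fun t => (C t)%:R) _ _ _ _ _ detV) => //.
    move=> s sA; have [_ _ _ le_s _] := AP s sA.
    by rewrite ltr0n !muln_gt0 !bin_gt0 expn_gt0 d_gt0; lia.
  by move=> s t _ _; rewrite mul1r natrM.
rewrite -(pmulr_lgt0 _ detDF) -sdet_mul.
rewrite (@eq_sdet _ _ _ _ (fun s u => (V s u * C u)%:R)) // => s u sA uA.
by rewrite sum_natrM MDF.
Qed.

(** * Decomposition by faces of the triangle *)

(** The fixed component only contributes the constant factor [c ^ c], which is
    positive even for [c = 0]; [l], [p] and [q] stand for the components in any
    order. *)
Lemma sdet_edge_gt0 (R : realFieldType) d (A : {set triple d})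
    (l p q : triple d -> nat) (c : nat) :
  (forall s t, power_entry s t = l s ^ l t * (p s ^ p t * q s ^ q t))%N ->
  {in A, forall t, [/\ l t = c, 0 < p t, 0 < q t & l t + p t + q t = d]%N} ->
  {in A &, forall s t, l s = l t -> p s = p t -> s = t} ->
  0 < sdet A (fun s t => (power_entry s t)%:R : R).
Proof.
move=> entryE AP A_inj.
have pq_gt0 : 0 < sdet A (fun s t => (p s ^ p t * q s ^ q t)%:R : R).
  apply: (sdet_two_powers_gt0 _ (N := (d - c)%N)) => [t tA|s t sA tA eq_p].
    by have [<- ? ? <-] := AP t tA; split=> //; lia.
  by have [ls _ _ _] := AP s sA; have [lt _ _ _] := AP t tA; apply: A_inj; rewrite ?ls ?lt.
apply: (sdet_scale_gt0 (r := fun=> (c ^ c)%:R) (c := fun=> 1) _ _ _ pq_gt0) => // [t _|s t sA tA].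
  by rewrite ltr0n expn_gt0; case: (c).
have [ls _ _ _] := AP s sA; have [lt _ _ _] := AP t tA.
by rewrite mulr1 -natrM entryE ls lt.
Qed.

Lemma sdet_fixed_i_gt0 (R : realFieldType) d (A : {set triple d}) (c : nat) :
  A \subset Idx d -> {in A, forall t, [/\ ci t = c, 0 < cj t & 0 < ck t]%N} ->
  0 < sdet A (fun s t => (power_entry s t)%:R : R).
Proof.
move=> /subsetP AI AP.
apply: (@sdet_edge_gt0 _ _ _ (@ci d) (@cj d) (@ck d) c) => [s t|t tA|s t sA tA].
- by rewrite /power_entry mulnA.
- by have [? ? ?] := AP t tA; have := AI t tA; rewrite inE => /eqP.
- by apply: triple_eq; apply: AI.
Qed.

Lemma sdet_fixed_j_gt0 (R : realFieldType) d (A : {set triple d}) (c : nat) :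
  A \subset Idx d -> {in A, forall t, [/\ cj t = c, 0 < ci t & 0 < ck t]%N} ->
  0 < sdet A (fun s t => (power_entry s t)%:R : R).
Proof.
move=> /subsetP AI AP.
apply: (@sdet_edge_gt0 _ _ _ (@cj d) (@ci d) (@ck d) c) => [s t|t tA|s t sA tA eq_j eq_i].
- by rewrite /power_entry mulnA [(cj s ^ _ * _)%N]mulnC.
- have [? ? ?] := AP t tA; have := AI t tA; rewrite inE => /eqP.
  by rewrite [(ci t + _)%N]addnC.
- by apply: triple_eq => //; apply: AI.
Qed.

Lemma sdet_fixed_k_gt0 (R : realFieldType) d (A : {set triple d}) (c : nat) :
  A \subset Idx d -> {in A, forall t, [/\ ck t = c, 0 < ci t & 0 < cj t]%N} ->
  0 < sdet A (fun s t => (power_entry s t)%:R : R).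
Proof.
move=> /subsetP AI AP.
apply: (@sdet_edge_gt0 _ _ _ (@ck d) (@ci d) (@cj d) c) => [s t|t tA|s t sA tA eq_k eq_i].
- by rewrite /power_entry mulnC.
- have [? ? ?] := AP t tA; have := AI t tA; rewrite inE => /eqP sum_t.
  by split=> //; lia.
- have := AI t tA; have := AI s sA; rewrite !inE => /eqP sum_s /eqP sum_t.
  by apply: triple_eq; rewrite ?inE ?sum_s ?sum_t //; lia.
Qed.

Definition interior d : {set triple d} :=
  [set t | [&& (0 < ci t)%N, (0 < cj t)%N & (0 < ck t)%N]].

(** Types 1 and 2 pass to subsets, and removing the boundary from a set of type 4
    raises its lower bounds to at least one. *)
Lemma sdet_interior_gt0 (R : realFieldType) d (A : {set triple d}) : (0 < d)%N ->
  A \subset Idx d ->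
  [\/ at_most_two A, fixed_component A | lower_bounded A] ->
  0 < sdet (A :&: interior d) (fun s t => (power_entry s t)%:R : R).
Proof.
move=> d_gt0 AI; have BI : A :&: interior d \subset Idx d.
  exact: subset_trans (subsetIl _ _) AI.
case=> [A2|A_fixed|[i0 [j0 [k0 defA]]]].
- by apply: sdet_at_most_two_gt0 => //; apply: leq_trans A2; rewrite subset_leq_card ?subsetIl.
- case: A_fixed => -[c fixed_c].
  + by apply: (@sdet_fixed_i_gt0 _ _ _ c) => // t; rewrite !inE => /andP[/fixed_c ? /and3P[]].
  + by apply: (@sdet_fixed_j_gt0 _ _ _ c) => // t; rewrite !inE => /andP[/fixed_c ? /and3P[]].
  + by apply: (@sdet_fixed_k_gt0 _ _ _ c) => // t; rewrite !inE => /andP[/fixed_c ? /and3P[]].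
- rewrite (_ : _ :&: _ = lower_set d (maxn 1 i0) (maxn 1 j0) (maxn 1 k0)).
    exact: sdet_lower_set_gt0.
  by rewrite defA; apply/setP=> t; rewrite !inE !geq_max; case: eqP => //= _; lia.
Qed.

Lemma sdet_union_boundary_gt0 (R : realFieldType) d (A B : {set triple d}) : (0 < d)%N ->
  A :|: B \subset Idx d ->
  [\/ at_most_two A, fixed_component A | lower_bounded A] ->
  on_boundary B ->
  0 < sdet (A :|: B) (fun s t => (power_entry s t)%:R : R).
Proof.
move=> d_gt0 ABI A_type B_bd; have [AI BI] := subUsetP ABI.
(* The support of [t] as a binary number: a code that is monotone for inclusion of
   supports, so that a nonzero entry never goes from a row of small code to a column
   of larger code. *)
pose face (t : triple d) := ((0 < ci t) * 4 + (0 < cj t) * 2 + (0 < ck t))%N.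
apply: (@sdet_block_gt0 _ _ _ face) => [s t _ _ lt_face|k].
  apply/eqP; rewrite pnatr_eq0 -leqn0 leqNgt.
  apply: contraL lt_face; rewrite -leqNgt /power_entry /face !muln_gt0 !expn_gt0.
  by lia.
set L := finset _.
have LI : L \subset Idx d.
  by apply: subset_trans ABI; apply/subsetP=> t; rewrite inE => /andP[].
have [->|[t0 t0L]] := set_0Vmem L.
  by rewrite sdet_diag ?big1 // => [t|t ?]; rewrite inE.
have faceL t : t \in L ->
    [/\ (0 < ci t)%N = (0 < ci t0)%N, (0 < cj t)%N = (0 < cj t0)%N
      & (0 < ck t)%N = (0 < ck t0)%N].
  move: t0L; rewrite !inE => /andP[_ /eqP <-] /andP[_ /eqP]; rewrite /face.
  by do 6!case: (0 < _)%N.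
have sumL t : t \in L -> (ci t + cj t + ck t)%N = d.
  by move/(subsetP LI); rewrite inE => /eqP.
have sum0 := sumL _ t0L.
have vertex : (forall s t, s \in L -> t \in L -> ci s = ci t /\ cj s = cj t) ->
    0 < sdet L (fun s t => (power_entry s t)%:R : R).
  move=> eqL; apply: sdet_at_most_two_gt0 => //; apply: leqW.
  apply/card_le1_eqP=> s t sL tL; have [? ?] := eqL s t sL tL.
  by apply: triple_eq; rewrite ?(subsetP LI).
case i0: (0 < ci t0)%N faceL => faceL; case j0: (0 < cj t0)%N faceL => faceL;
  case k0: (0 < ck t0)%N faceL => faceL.
- rewrite (_ : L = A :&: interior d); first exact: sdet_interior_gt0.
  apply/setP=> t; apply/idP/idP => [tL|].
    have [ti tj tk] := faceL t tL; move: tL; rewrite !inE ti tj tk !andbT.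
    case/andP=> /orP[//|/(subsetP B_bd)]; rewrite !inE !eqn0Ngt ti tj tk.
    by rewrite !andbF.
  rewrite !inE => /andP[-> /and3P[ti tj tk]].
  move: t0L; rewrite !inE => /andP[_ /eqP <-].
  by rewrite /face ti tj tk i0 j0 k0.
- apply: (@sdet_fixed_k_gt0 _ _ _ 0) => // t /faceL[-> -> tk]; split=> //.
  by case: (ck t) tk.
- apply: (@sdet_fixed_j_gt0 _ _ _ 0) => // t /faceL[-> tj ->]; split=> //.
  by case: (cj t) tj.
- apply: vertex => s t /[dup] /sumL ? /faceL[? ? ?] /[dup] /sumL ? /faceL[? ? ?].
  by split; lia.
- apply: (@sdet_fixed_i_gt0 _ _ _ 0) => // t /faceL[ti -> ->]; split=> //.
  by case: (ci t) ti.
- apply: vertex => s t /[dup] /sumL ? /faceL[? ? ?] /[dup] /sumL ? /faceL[? ? ?].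
  by split; lia.
- apply: vertex => s t /[dup] /sumL ? /faceL[? ? ?] /[dup] /sumL ? /faceL[? ? ?].
  by split; lia.
- by move: d_gt0; lia.
Qed.

Theorem theorem4 (R : realFieldType) (d : nat) (hd : (0 < d)%N)
  (Gamma : {set triple d}) (hsub : Gamma \subset Idx d) (hne : Gamma != set0)
  (hGamma : at_most_two Gamma \/ fixed_component Gamma \/ Gamma = Idx d \/
            lower_bounded Gamma \/ on_boundary Gamma \/
            union_with_boundary Gamma) :
  0 < \det (colloc_mx R Gamma).
Proof.
apply: colloc_det_gt0 => //.
have bd0 : on_boundary (@set0 (triple d)) by apply: sub0set.
suff [A [B [defG typeA typeB]]] : union_with_boundary Gamma.
  by rewrite defG; apply: sdet_union_boundary_gt0; rewrite -?defG.
have only_A : [\/ at_most_two Gamma, fixed_component Gamma | lower_bounded Gamma] ->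
    union_with_boundary Gamma.
  by exists Gamma, set0; split; rewrite ?setU0.
case: hGamma => [?|[?|[defG|[?|[bdG|//]]]]].
- by apply: only_A; apply: Or31.
- by apply: only_A; apply: Or32.
- apply: only_A; apply: Or33; exists 0, 0, 0; rewrite defG.
  by apply/setP=> t; rewrite !inE !andbT.
- by apply: only_A; apply: Or33.
- by exists set0, Gamma; split; rewrite ?set0U //; apply: Or31; rewrite /at_most_two cards0.
Qed.
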